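(* Let $F$ be a finite simple graph without isolated nodes that contains the cycle $C_4$ or the cycle $C_6$ as a (not necessarily induced) subgraph. Then $F$ is weakly locally common.
   Context: $C_k$ denotes the cycle with $k$ nodes. A kernel is a bounded measurable symmetric function $W:[0,1]^2\to\mathbb{R}$. Let $\mathcal{W}_1$ denote the set of kernels with values in $[-1,1]$. For a finite simple graph $F$ and a kernel $W$, define $$t(F,W)=\int_{[0,1]^{V(F)}}\prod_{ij\in E(F)}W(x_i,x_j)\prod_{i\in V(F)}dx_i .$$ Here $1\pm\varepsilon U$ denotes the kernel $(x,y)\mapsto 1\pm\varepsilon U(x,y)$. A simple graph $F$ is weakly locally common if for every $U\in\mathcal{W}_1$ there is an $\varepsilon_U>0$ such that $t(F,1+\varepsilon U)+t(F,1-\varepsilon U)\ge 2$ for all $0\le\varepsilon\le\varepsilon_U$. *)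

(* Defs.v *)
From HB Require Import structures.
From mathcomp Require Import all_boot all_order all_algebra.
From mathcomp Require Import all_classical all_reals all_analysis.
Set Implicit Arguments.
Unset Strict Implicit.
Unset Printing Implicit Defensive.
Import Order.TTheory GRing.Theory Num.Theory.
Local Open Scope classical_set_scope.
Local Open Scope ring_scope.

Record sgraph := SGraph {
  vert :> finType;
  adj : rel vert;
  adj_sym : symmetric adj;
  adj_irrefl : irreflexive adj }.

Definition no_isolated (F : sgraph) := forall v : F, exists w : F, adj v w.

Definition contains (F H : sgraph) :=
  exists2 f : H -> F, injective f & forall x y, adj x y -> adj (f x) (f y).

(* [ordS] is the cyclic successor i |-> i + 1 mod k; for k >= 3 this is the
   cycle with k nodes. *)
Definition cycle_adj (k : nat) : rel 'I_k :=
  fun i j => (i != j) && ((j == ordS i) || (i == ordS j)).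

Lemma cycle_adj_sym k : symmetric (@cycle_adj k).
Proof. by move=> i j; rewrite /cycle_adj eq_sym orbC. Qed.

Lemma cycle_adj_irrefl k : irreflexive (@cycle_adj k).
Proof. by move=> i; rewrite /cycle_adj eqxx. Qed.

Definition cycle_graph (k : nat) : sgraph :=
  SGraph (@cycle_adj_sym k) (@cycle_adj_irrefl k).

(* Lebesgue measure on R^n, as the n-fold product of [lebesgue_measure]: the
   product measure on R * R^n is carried over to R^(n+1) by consing. *)
Section lebesgue_tuple.
Variable R : realType.

Definition tcons n (p : (R * n.-tuple R)%type) : n.+1.-tuple R :=
  [tuple of p.1 :: p.2].

Fixpoint lebesgue_tuple n : set (n.-tuple R) -> \bar R :=
  if n is m.+1
  then pushforward (lebesgue_measure \x lebesgue_tuple (n := m))%E (@tcons m)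
  else \d_ [tuple].

Lemma measurable_tcons n :
  measurable_fun [set: (R * n.-tuple R)%type] (@tcons n).
Proof. exact: measurable_cons. Qed.

Section lebesgue_tcons.
Variables (n : nat) (m : {sigma_finite_measure set (n.-tuple R) -> \bar R}).

Definition lebesgue_tcons : set (n.+1.-tuple R) -> \bar R :=
  pushforward (lebesgue_measure \x m)%E (@tcons n).

Let nu : {measure set (n.+1.-tuple R) -> \bar R} :=
  measure_function_pushforward__canonical__measure_function_Measure
    (lebesgue_measure \x m)%E (@measurable_tcons n).

HB.instance Definition _ := isMeasure.Build _ _ _ lebesgue_tcons
  (measure0 nu) (@measure_ge0 _ _ _ nu) (@measure_semi_sigma_additive _ _ _ nu).

(* Sigma-finiteness of the product is redone here because the canonical
   instance on [product_measure1] is keyed on pairs of measures. *)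
Let sigma_finite_lebesgue_tcons : sigma_finite setT lebesgue_tcons.
Proof.
have [A [TA fA]] : exists A : (set (measurableTypeR R * n.-tuple R))^nat,
    setT = \bigcup_k A k /\
    forall k, measurable (A k) /\ ((lebesgue_measure \x m) (A k) < +oo)%E.
  have /sigma_finiteP[B [TB ndB Boo]] := sigma_finiteT (@lebesgue_measure R).
  have /sigma_finiteP[C [TC ndC Coo]] := sigma_finiteT m.
  exists (fun k => B k `*` C k); split.
    rewrite -setXTT TB TC predeqE => -[x y]; split.
      move=> [/= [i _ Bix] [j _ Cjy]]; exists (maxn i j) => //; split.
      - by move: x Bix; exact/subsetPset/ndB/leq_maxl.
      - by move: y Cjy; exact/subsetPset/ndC/leq_maxr.
    by move=> [i _ []/= ? ?]; split; exists i.
  move=> k; have [? ?] := Boo k; have [? ?] := Coo k.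
  split; first exact: measurableX.
  by rewrite product_measure1E// lte_mul_pinfty// ge0_fin_numE.
pose g (t : n.+1.-tuple R) : (R * n.-tuple R)%type :=
  (thead t, [tuple of behead t]).
have tK : g \o @tcons n = id.
  by apply/funext => -[x t]; rewrite /g /= theadE; congr pair; apply/val_inj.
have mg : measurable_fun setT g.
  apply/measurable_fun_pair; first exact: measurable_tnth.
  exact: measurable_behead.
exists (fun k => g @^-1` A k) => [|k]; first by rewrite -preimage_bigcup -TA.
have [mA lA] := fA k.
split; first by rewrite -[X in measurable X]setTI; exact: mg.
by rewrite /lebesgue_tcons /pushforward -comp_preimage tK.
Qed.

HB.instance Definition _ := Measure_isSigmaFinite.Build _ _ _ lebesgue_tcons
  sigma_finite_lebesgue_tcons.

End lebesgue_tcons.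

Lemma lebesgue_tupleE n :
  exists m : {sigma_finite_measure set (n.-tuple R) -> \bar R},
    m = @lebesgue_tuple n :> (_ -> _).
Proof.
elim: n => [|n [m mE]]; first by exists (\d_ [tuple]).
by exists (lebesgue_tcons m); rewrite /= -mE.
Qed.

Section lebesgue_tuple_measure.
Variable n : nat.
Notation mu := (@lebesgue_tuple n).

Let mu0 : mu set0 = 0%E.
Proof. by have [m <-] := lebesgue_tupleE n; exact: measure0. Qed.

Let mu_ge0 A : (0 <= mu A)%E.
Proof. by have [m <-] := lebesgue_tupleE n; exact: measure_ge0. Qed.

Let mu_sigma_additive : semi_sigma_additive mu.
Proof.
by have [m <-] := lebesgue_tupleE n; exact: measure_semi_sigma_additive.
Qed.

HB.instance Definition _ := isMeasure.Build _ _ _ mu mu0 mu_ge0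
  mu_sigma_additive.

Let mu_sigma_finite : sigma_finite setT mu.
Proof. by have [m <-] := lebesgue_tupleE n; exact: sigma_finiteT. Qed.

HB.instance Definition _ := Measure_isSigmaFinite.Build _ _ _ mu
  mu_sigma_finite.

End lebesgue_tuple_measure.
End lebesgue_tuple.

Section kernels.
Variable R : realType.
Implicit Types W U : R * R -> R.

Definition unit_itv : set R := `[0, 1]%classic.
Definition unit_square : set (R * R) := unit_itv `*` unit_itv.

(* Only the values of a function on the unit square matter. *)
Record is_kernel W : Prop := IsKernel {
  kernel_measurable : measurable_fun unit_square W;
  kernel_bounded : exists M : R, forall p, unit_square p -> `|W p| <= M;
  kernel_sym : forall x y, unit_itv x -> unit_itv y -> W (x, y) = W (y, x) }.

Definition kernel_W1 W :=
  is_kernel W /\ forall p, unit_square p -> -1 <= W p <= 1.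

Definition unit_cube n : set (n.-tuple R) :=
  [set x | forall i, unit_itv (tnth x i)].

Section hom_density.
Variable F : sgraph.

(* Each edge is counted once, as the pair of its end nodes in the order in
   which [enum_rank] lists the nodes of F; the order is immaterial for a
   symmetric W. *)
Definition edge_pair (e : F * F) :=
  adj e.1 e.2 && (enum_rank e.1 < enum_rank e.2)%N.

Definition hom_density W : R :=
  \int[@lebesgue_tuple R #|F|]_(x in @unit_cube #|F|)
    \prod_(e : F * F | edge_pair e)
       W (tnth x (enum_rank e.1), tnth x (enum_rank e.2)).

End hom_density.

Definition weakly_locally_common (F : sgraph) :=
  forall U, kernel_W1 U -> exists2 epsU : R, 0 < epsU &
    forall eps : R, 0 <= eps <= epsU ->
      2 <= hom_density F (fun p => 1 + eps * U p) +
           hom_density F (fun p => 1 - eps * U p).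

End kernels.

Arguments weakly_locally_common R F : clear implicits.

(* Main.v *)
Require Import Defs.
From mathcomp Require Import all_boot all_order all_algebra.
From mathcomp Require Import all_classical all_reals all_analysis.
From mathcomp Require Import measurable_realfun.
From mathcomp Require Import ring lra.
Set Implicit Arguments.
Unset Strict Implicit.
Unset Printing Implicit Defensive.
Import Order.TTheory GRing.Theory Num.Theory.
Import numFieldNormedType.Exports.
Local Open Scope classical_set_scope.
Local Open Scope ring_scope.

(** Expanding the product over the edges writes t(F, 1 + cU) as the sum of
    c^|S| t(S, U) over the sets S of edges of F.  In
    t(F, 1 + eU) + t(F, 1 - eU) the sets of odd size cancel and the empty set
    contributes 2, so for small e the sign of the difference with 2 is that of
    the lowest order at which something survives ([even_sum_ge0]): it is enough
    to find an even N such that every nonempty S of even size at most N has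
    t(S, U) >= 0 and some S of size N has t(S, U) > 0, or else to see that
    every nonempty S has t(S, U) = 0.

    Order 2.  Two disjoint edges have density t(K2, U)^2 and two adjacent ones
    the mean of the square of the degree function x |-> \int U(x, y) dy.  If
    the degree function is not null, N = 2 works.  If it is, every S with a
    vertex of degree 1 has density 0 ([density_leaf]), and from now on only
    leafless S count.

    Order 4.  A leafless set of four edges is a 4-cycle ([leafless4]), whose
    density is the squared L2 norm of the iterated kernel UU.  If this norm is
    positive and F contains C4, then N = 4 works.  If it is zero, then every
    nonempty S has density 0 ([density_C4_0]).

    Order 6.  There remains the case where F contains C6 but not C4.  A
    leafless set of six edges is then a hexagon, with density the squared norm
    of UUU, or a pair of triangles with at most one common vertex, with density
    the integral of a square or the square of an integral.  The norm of UUU is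
    positive: t(C4, U) is the inner product of UUU with U, so that UUU = 0
    would give t(C4, U) = 0, which has been dealt with.  Hence N = 6 works.

    No almost-everywhere statement is needed: each vanishing is an instance of
    the fact that a bounded function whose square has mean 0 is orthogonal to
    all bounded functions ([mean_sqr0]).  The integrals are computed by
    averaging one coordinate at a time, which does not change the integral over
    the cube ([cmean_avg_at]). *)

(** * Means of bounded measurable functions *)

Section bounded_measurable.
Context d (T : measurableType d) (R : realType).
Implicit Types f g : T -> R.

Definition bmfun f :=
  measurable_fun setT f /\ exists M : R, forall x, `|f x| <= M.

Lemma bmfun_cst (c : R) : bmfun (fun=> c).
Proof. by split; [exact: measurable_cst | exists `|c|]. Qed.

Lemma bmfunD f g : bmfun f -> bmfun g -> bmfun (f + g).
Proof.
move=> [mf [M fM]] [mg [N gN]]; split; first exact: measurable_funD.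
exists (M + N) => x; rewrite !fctE; exact: le_trans (ler_normD _ _) (lerD _ _).
Qed.

Lemma bmfunM f g : bmfun f -> bmfun g -> bmfun (f * g).
Proof.
move=> [mf [M fM]] [mg [N gN]]; split; first exact: measurable_funM.
by exists (M * N) => x; rewrite !fctE normrM ler_pM.
Qed.

Lemma bmfunZ (c : R) f : bmfun f -> bmfun (fun x => c * f x).
Proof. by move=> bf; apply: (bmfunM (bmfun_cst c) bf). Qed.

Lemma bmfun_prod (I : eqType) (s : seq I) (P : pred I) (F : I -> T -> R) :
  (forall i, P i -> bmfun (F i)) -> bmfun (\prod_(i <- s | P i) F i).
Proof.
move=> bF; elim/big_rec: _ => [|i x Pi bx]; first exact: bmfun_cst.
exact: bmfunM (bF _ Pi) bx.
Qed.

Section mean.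
Variables (mu : {measure set T -> \bar R}) (D : set T).
Hypotheses (mD : measurable D) (mu1 : mu D = 1%:E).

Lemma bmfun_integrable f : bmfun f -> mu.-integrable D (EFin \o f).
Proof.
move=> [mf [M fM]]; apply: measurable_bounded_integrable => //.
- by rewrite mu1 ltry.
- exact: measurable_funTS.
- exists M; split; first exact: num_real.
  by move=> y My x _ /=; exact: le_trans (fM x) (ltW My).
Qed.

Notation mean f := (\int[mu]_(x in D) f x).

Lemma meanD f g : bmfun f -> bmfun g -> mean (f + g) = mean f + mean g.
Proof. by move=> bf bg; rewrite RintegralD//; exact: bmfun_integrable. Qed.

Lemma meanZ (c : R) f : bmfun f -> mean (fun x => c * f x) = c * mean f.
Proof. by move=> bf; rewrite RintegralZl//; exact: bmfun_integrable. Qed.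

Lemma mean_cst (c : R) : mean (fun=> c) = c.
Proof. by rewrite Rintegral_cst// mu1 mulr1. Qed.

Lemma ler_mean f g : bmfun f -> bmfun g -> (forall x, D x -> f x <= g x) ->
  mean f <= mean g.
Proof. by move=> bf bg fg; apply: le_Rintegral => //; exact: bmfun_integrable. Qed.

Lemma mean_ge0 f : (forall x, D x -> 0 <= f x) -> 0 <= mean f.
Proof. exact: Rintegral_ge0. Qed.

Lemma mean_norm_le f (M : R) : bmfun f -> (forall x, D x -> `|f x| <= M) ->
  `|mean f| <= M.
Proof.
move=> bf fM; rewrite ler_norml -{1}(mean_cst (- M)) -{2}(mean_cst M).
apply/andP; split; apply: ler_mean => //; try exact: bmfun_cst.
  by move=> x /fM; rewrite ler_norml => /andP[].
by move=> x /fM; rewrite ler_norml => /andP[].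
Qed.

Lemma mean_sum (I : eqType) (s : seq I) (P : pred I) (F : I -> T -> R) :
  (forall i, P i -> bmfun (F i)) ->
  mean (\sum_(i <- s | P i) F i) = \sum_(i <- s | P i) mean (F i).
Proof.
move=> bF; have : bmfun (\sum_(i <- s | P i) F i) /\
   mean (\sum_(i <- s | P i) F i) = \sum_(i <- s | P i) mean (F i); last by case.
elim/big_rec2: _ => [|i x y Pi [by_ ih]].
  by split; [exact: bmfun_cst | exact: mean_cst].
by split; [exact: bmfunD (bF _ Pi) by_ | rewrite meanD ?ih//; exact: bF].
Qed.

(** The mean of (f + s g)^2 is nonnegative for every real s and has no constant
    term as a polynomial in s, so its linear coefficient is zero. *)
Lemma mean_sqr0 f g : bmfun f -> bmfun g -> mean (f * f) = 0 ->
  mean (f * g) = 0.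
Proof.
move=> bf bg ff0; set b := mean (f * g); set c := mean (g * g).
have c0 : 0 <= c by apply: mean_ge0 => x _; exact: sqr_ge0.
have key (s : R) : 0 <= 2 * s * b + s ^+ 2 * c.
  have -> : 2 * s * b + s ^+ 2 * c =
      mean (f * f + ((fun x => (2 * s) * (f * g) x) + (fun x => s ^+ 2 * (g * g) x))).
    have bfg := bmfunM bf bg; have bgg := bmfunM bg bg.
    rewrite meanD ?ff0 ?add0r ?meanD ?meanZ//; try exact: bmfunZ.
      exact: bmfunM.
    by apply: bmfunD; exact: bmfunZ.
  apply: mean_ge0 => x _; rewrite !fctE.
  have -> : f x * f x + (2 * s * (f x * g x) + s ^+ 2 * (g x * g x)) =
    (f x + s * g x) ^+ 2 by ring.
  exact: sqr_ge0.
have c1 : 0 < c + 1 by rewrite ltr_wpDl.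
(* The minimum is at - b / c; c + 1 takes the place of c, which may be 0. *)
have := key (- b / (c + 1)).
have -> : 2 * (- b / (c + 1)) * b + (- b / (c + 1)) ^+ 2 * c =
  - (b ^+ 2 * ((c + 2) / (c + 1) ^+ 2)) by field; rewrite gt_eqF.
rewrite oppr_ge0 pmulr_lle0; last first.
  by rewrite divr_gt0 ?exprn_gt0// ltr_wpDl.
by move=> b2; apply/eqP; rewrite -sqrf_eq0 eq_le b2 sqr_ge0.
Qed.

End mean.
End bounded_measurable.

Lemma bmfun_comp d1 d2 (T1 : measurableType d1) (T2 : measurableType d2)
    (R : realType) (h : T1 -> T2) (f : T2 -> R) :
  measurable_fun setT h -> bmfun f -> bmfun (f \o h).
Proof.
move=> mh [mf [M fM]]; split; first exact: measurableT_comp.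
by exists M => x; exact: fM.
Qed.

Section Fubini_bounded.
Context d1 d2 (T1 : measurableType d1) (T2 : measurableType d2) (R : realType).
Variables (m1 : {sigma_finite_measure set T1 -> \bar R}) (D1 : set T1).
Variables (m2 : {sigma_finite_measure set T2 -> \bar R}) (D2 : set T2).
Hypotheses (mD1 : measurable D1) (m1D : m1 D1 = 1%:E).
Hypotheses (mD2 : measurable D2) (m2D : m2 D2 = 1%:E).

Let prodD : (m1 \x m2)%E (D1 `*` D2) = 1%:E.
Proof.
transitivity (m1 D1 * m2 D2)%E; first exact: product_measure1E.
by rewrite m1D m2D mule1.
Qed.

(** The integral is made nonnegative by adding the bound M, so that Tonelli
    gives the measurability in the parameter; T3 carries no measure here. *)
Lemma bmfun_mean d3 (T3 : measurableType d3) (h : T3 * T2 -> R) :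
  bmfun h -> bmfun (fun x => \int[m2]_(y in D2) h (x, y)).
Proof.
move=> bh; have [mh [M hM]] := bh.
have bx x : bmfun (fun y => h (x, y)).
  by split; [exact: measurableT_comp mh (measurable_pair1 x) | exists M].
split; last first.
  by exists M => x; apply: mean_norm_le => // y _; exact: hM.
pose g (z : T3 * T2) : \bar R := (((h z + M) * \1_D2 z.2))%:E.
have g0 z : (0 <= g z)%E.
  rewrite lee_fin mulr_ge0//; have := hM z; rewrite ler_norml => /andP[hz _].
  by rewrite -lerBlDr sub0r.
have mg : measurable_fun setT g.
  apply/measurable_EFinP/measurable_funM.
    by apply: measurable_funD => //; exact: measurable_cst.
  by apply: measurableT_comp => //; exact: measurable_snd.
have := measurable_fun_fubini_tonelli_F (m2 := m2) g mg g0.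
move=> /(measurableT_comp (@fine_measurable R _ measurableT)) mF.
have -> : (fun x => \int[m2]_(y in D2) h (x, y)) =
    (fun x => fine (fubini_F m2 g x) - M).
  apply/funext => x; rewrite /fubini_F /g.
  have -> : (\int[m2]_y ((h (x, y) + M) * \1_D2 y)%:E =
             \int[m2]_(y in D2) (h (x, y) + M)%:E)%E.
    rewrite [RHS]integral_mkcond; apply: eq_integral => y _.
    by rewrite restrict_EFin patch_indic.
  rewrite -[fine _]/(\int[m2]_(y in D2) ((fun y => h (x, y)) + (fun=> M)) y).
  by rewrite meanD ?mean_cst ?addrK//; exact: bmfun_cst.
apply: measurable_funB => //; exact: measurable_cst.
Qed.

Lemma mean_Fubini1 (h : T1 * T2 -> R) : bmfun h ->
  \int[(m1 \x m2)%E]_(z in D1 `*` D2) h z =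
  \int[m1]_(x in D1) \int[m2]_(y in D2) h (x, y).
Proof.
move=> bh; have [mh [M hM]] := bh.
have bx x : bmfun (fun y => h (x, y)).
  by split; [exact: measurableT_comp mh (measurable_pair1 x) | exists M].
have mD := measurableX mD1 mD2.
have ih := bmfun_integrable mD prodD bh.
rewrite /Rintegral integral_mkcond.
rewrite -integral12_prod_meas1; last exact: (proj1 (integrable_mkcond _ mD) ih).
congr fine; rewrite [RHS]integral_mkcond; apply: eq_integral => x _.
rewrite /fubini_F patchE; case: ifPn => [xD|xD].
  rewrite fineK; last first.
    exact: (integrable_fin_num mD2 (bmfun_integrable mD2 m2D (bx x))).
  rewrite [RHS]integral_mkcond; apply: eq_integral => y _.
  by rewrite !patchE in_setX/= xD.
rewrite (eq_integral (cst 0%E)) ?integral0// => y _.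
by rewrite !patchE in_setX/= (negbTE xD).
Qed.

Lemma mean_Fubini2 (h : T1 * T2 -> R) : bmfun h ->
  \int[(m1 \x m2)%E]_(z in D1 `*` D2) h z =
  \int[m2]_(y in D2) \int[m1]_(x in D1) h (x, y).
Proof.
move=> bh; have [mh [M hM]] := bh.
have bx y : bmfun (fun x => h (x, y)).
  by split; [exact: measurableT_comp mh (measurable_pair2 y) | exists M].
have mD := measurableX mD1 mD2.
have ih := bmfun_integrable mD prodD bh.
rewrite /Rintegral integral_mkcond.
rewrite -integral21_prod_meas1; last exact: (proj1 (integrable_mkcond _ mD) ih).
congr fine; rewrite [RHS]integral_mkcond; apply: eq_integral => y _.
rewrite /fubini_G patchE; case: ifPn => [yD|yD].
  rewrite fineK; last first.
    exact: (integrable_fin_num mD1 (bmfun_integrable mD1 m1D (bx y))).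
  rewrite [RHS]integral_mkcond; apply: eq_integral => x _.
  by rewrite !patchE in_setX/= yD andbT.
rewrite (eq_integral (cst 0%E)) ?integral0// => x _.
by rewrite !patchE in_setX/= (negbTE yD) andbF.
Qed.
End Fubini_bounded.

(** * Integration over the unit cube, one coordinate at a time *)

Section cube.
Variable R : realType.
Local Notation itv := (@unit_itv R).
Local Notation cube n := (@unit_cube R n).

Definition avg (f : R -> R) : R := \int[lebesgue_measure]_(y in itv) f y.

(** The mean over the unit cube; for n = #|F| this is the integral that
    defines homomorphism densities. *)
Definition cmean n (f : n.-tuple R -> R) : R :=
  \int[@lebesgue_tuple R n]_(x in cube n) f x.

Lemma measurable_unit_itv : measurable itv.
Proof. exact: measurable_itv. Qed.

Lemma lebesgue_unit_itv : lebesgue_measure itv = 1%:E :> \bar R.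
Proof. by rewrite /unit_itv lebesgue_measure_itv/= lte_fin ltr01 oppr0 adde0. Qed.

Lemma measurable_unit_cube n : measurable (cube n).
Proof.
have -> : cube n = \big[setI/setT]_(i < n) ((fun x => tnth x i) @^-1` itv).
  rewrite -bigcap_seq; apply/seteqP; split => x /= xc.
    by move=> i _; exact: xc.
  by move=> i; apply: (xc i); rewrite /= mem_index_enum.
apply: bigsetI_measurable => i _; rewrite -[X in measurable X]setTI.
exact: measurable_tnth measurable_unit_itv.
Qed.

Lemma tcons_unit_cube n : @tcons R n @^-1` cube n.+1 = itv `*` cube n.
Proof.
apply/seteqP; split=> [[y t] /= yt|[y t] /= [yi ti] i].
  split=> [|i]; first by have := yt ord0; rewrite (tnth_nth 0).
  by have := yt (lift ord0 i); rewrite tnthS.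
by case: (unliftP ord0 i) => [j ->|->]; rewrite ?tnthS// tnth0.
Qed.

Lemma lebesgue_unit_cube n : @lebesgue_tuple R n (cube n) = 1%:E.
Proof.
elim: n => [|n ih].
  rewrite /= diracE mem_set//; by case.
rewrite /= /pushforward tcons_unit_cube.
transitivity (lebesgue_measure itv * @lebesgue_tuple R n (cube n))%E.
  by apply: product_measure1E; [exact: measurable_unit_itv |
    exact: measurable_unit_cube].
by rewrite lebesgue_unit_itv ih mule1.
Qed.

Lemma bmfun_avg d (T : measurableType d) (h : T * R -> R) :
  bmfun h -> bmfun (fun x => avg (fun y => h (x, y))).
Proof.
exact: (bmfun_mean (m2 := lebesgue_measure) measurable_unit_itv
  lebesgue_unit_itv).
Qed.

Lemma avgZ (c : R) f : bmfun f -> avg (fun x => c * f x) = c * avg f.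
Proof.
exact: (meanZ (mu := lebesgue_measure) measurable_unit_itv lebesgue_unit_itv).
Qed.

Lemma avg_cst (c : R) : avg (fun=> c) = c.
Proof.
exact: (mean_cst (mu := lebesgue_measure) measurable_unit_itv
  lebesgue_unit_itv).
Qed.

Section cmean_theory.
Variable n : nat.
Implicit Types f g : n.-tuple R -> R.
Let mc := @measurable_unit_cube n.
Let c1 := @lebesgue_unit_cube n.

Lemma cmeanZ (c : R) f : bmfun f -> cmean (fun x => c * f x) = c * cmean f.
Proof. exact: (meanZ mc c1). Qed.

Lemma cmean_cst (c : R) : @cmean n (fun=> c) = c.
Proof. exact: (mean_cst mc c1). Qed.

Lemma cmean_ge0 f : (forall x, 0 <= f x) -> 0 <= cmean f.
Proof. by move=> f0; apply: mean_ge0 => x _; exact: f0. Qed.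

Lemma cmean_norm_le f (M : R) :
  bmfun f -> (forall x, `|f x| <= M) -> `|cmean f| <= M.
Proof. by move=> bf fM; apply: (mean_norm_le mc c1) => // x _; exact: fM. Qed.

Lemma cmean_sum (I : eqType) (s : seq I) (P : pred I) (F : I -> n.-tuple R -> R) :
  (forall i, P i -> bmfun (F i)) ->
  cmean (\sum_(i <- s | P i) F i) = \sum_(i <- s | P i) cmean (F i).
Proof. exact: (mean_sum mc c1). Qed.

Lemma cmean_sqr0 f g : bmfun f -> bmfun g -> cmean (f * f) = 0 ->
  cmean (f * g) = 0.
Proof. exact: (mean_sqr0 mc c1). Qed.

End cmean_theory.

Lemma cmean_tcons n (f : n.+1.-tuple R -> R) : bmfun f ->
  cmean f = \int[(lebesgue_measure \x @lebesgue_tuple R n)%E]_(z in itv `*` cube n)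
              f (tcons z).
Proof.
move=> bf; rewrite /cmean /Rintegral -tcons_unit_cube; congr fine.
refine (integral_pushforward (X := (measurableTypeR R * n.-tuple R)%type)
  (phi := @tcons R n) (mu := (lebesgue_measure \x @lebesgue_tuple R n)%E)
  (f := EFin \o f) _ _ _ _).
- exact: measurable_tcons.
- by apply/measurable_EFinP; case: bf.
- rewrite tcons_unit_cube; apply: bmfun_integrable.
  + by apply: measurableX; [exact: measurable_unit_itv | exact: measurable_unit_cube].
  + have := @lebesgue_unit_cube n.+1.
    by rewrite /= /pushforward tcons_unit_cube.
  + exact: bmfun_comp (@measurable_tcons R n) bf.
- exact: measurable_unit_cube.
Qed.

Lemma cmeanS n (f : n.+1.-tuple R -> R) : bmfun f ->
  cmean f = avg (fun y => cmean (fun t => f (tcons (y, t)))).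
Proof.
move=> bf; rewrite cmean_tcons//.
apply: (@mean_Fubini1 _ _ (measurableTypeR R) (n.-tuple R) R
  lebesgue_measure _ (@lebesgue_tuple R n) _ measurable_unit_itv lebesgue_unit_itv
  (@measurable_unit_cube n) (@lebesgue_unit_cube n) (f \o @tcons R n)).
exact: bmfun_comp (@measurable_tcons R n) bf.
Qed.

Lemma cmeanSr n (f : n.+1.-tuple R -> R) : bmfun f ->
  cmean f = cmean (fun t => avg (fun y => f (tcons (y, t)))).
Proof.
move=> bf; rewrite cmean_tcons//.
apply: (@mean_Fubini2 _ _ (measurableTypeR R) (n.-tuple R) R
  lebesgue_measure _ (@lebesgue_tuple R n) _ measurable_unit_itv lebesgue_unit_itv
  (@measurable_unit_cube n) (@lebesgue_unit_cube n) (f \o @tcons R n)).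
exact: bmfun_comp (@measurable_tcons R n) bf.
Qed.

Definition upd n (t : n.-tuple R) (i : 'I_n) (y : R) : n.-tuple R :=
  [tuple if j == i then y else tnth t j | j < n].

Lemma tnth_upd n (t : n.-tuple R) i y j :
  tnth (upd t i y) j = if j == i then y else tnth t j.
Proof. by rewrite tnth_mktuple. Qed.

Lemma updC n (t : n.-tuple R) i j y z : i != j ->
  upd (upd t i y) j z = upd (upd t j z) i y.
Proof.
move=> ij; apply: eq_from_tnth => k; rewrite !tnth_upd.
by case: (eqVneq k j) => // ->; rewrite eq_sym (negbTE ij).
Qed.

Lemma updK n (t : n.-tuple R) i y z : upd (upd t i y) i z = upd t i z.
Proof. by apply: eq_from_tnth => k; rewrite !tnth_upd; case: eqP. Qed.

Lemma upd_tcons0 n (t : n.-tuple R) x y :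
  upd (tcons (x, t)) ord0 y = tcons (y, t).
Proof.
apply: eq_from_tnth => k; rewrite tnth_upd.
by case: (unliftP ord0 k) => [j ->|->]; rewrite ?tnthS ?tnth0.
Qed.

Lemma upd_tconsS n (t : n.-tuple R) i x y :
  upd (tcons (x, t)) (lift ord0 i) y = tcons (x, upd t i y).
Proof.
apply: eq_from_tnth => k; rewrite tnth_upd.
case: (unliftP ord0 k) => [j ->|->]; rewrite ?tnthS ?tnth0//.
by rewrite tnth_upd (inj_eq lift_inj).
Qed.

Lemma measurable_upd n (i : 'I_n) :
  measurable_fun setT (fun z : n.-tuple R * R => upd z.1 i z.2).
Proof.
apply/measurable_fun_tnthP => j.
rewrite [X in measurable_fun _ X](_ : _ = fun z : n.-tuple R * R =>
  if j == i then z.2 else tnth z.1 j); last first.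
  by apply/funext => z /=; rewrite tnth_upd.
case: eqP => _; first exact: measurable_snd.
exact: measurableT_comp (measurable_tnth j) measurable_fst.
Qed.

(** The conditional expectation of f given all coordinates but the i-th. *)
Definition avg_at n (i : 'I_n) (f : n.-tuple R -> R) (t : n.-tuple R) : R :=
  avg (fun y => f (upd t i y)).

Definition free_of n (i : 'I_n) (f : n.-tuple R -> R) :=
  forall t y, f (upd t i y) = f t.

Lemma bmfun_updr n (f : n.-tuple R -> R) (i : 'I_n) t :
  bmfun f -> bmfun (fun y => f (upd t i y)).
Proof.
apply: (@bmfun_comp _ _ _ _ R (fun y => upd t i y)).
exact: measurableT_comp (measurable_upd i) (measurable_pair1 t).
Qed.

Lemma bmfun_avg_at n (i : 'I_n) f : bmfun f -> bmfun (avg_at i f).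
Proof.
move=> bf; apply: (@bmfun_avg _ _ (fun z => f (upd z.1 i z.2))).
exact: bmfun_comp (measurable_upd i) bf.
Qed.

Lemma free_avg_at n (i : 'I_n) f : free_of i (avg_at i f).
Proof.
by move=> t y; congr avg; apply/funext => z; rewrite updK.
Qed.

Lemma avg_at_mulr n (i : 'I_n) f g : bmfun f -> free_of i g ->
  avg_at i (f * g) = avg_at i f * g.
Proof.
move=> bf fg; apply/funext => t; rewrite !fctE [RHS]mulrC.
rewrite -[RHS](avgZ _ (bmfun_updr i t bf)); congr avg; apply/funext => y.
by rewrite fg mulrC.
Qed.

(** Fubini at an arbitrary coordinate.  The measure on the cube is built by
    consing one coordinate at a time: the integral over coordinate 0 is moved
    inside the others ([cmeanSr]), and the other coordinates go by induction. *)
Lemma cmean_avg_at n (i : 'I_n) f : bmfun f -> cmean (avg_at i f) = cmean f.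
Proof.
elim: n i f => [[]//|n ih] i f bf.
have bfy y : bmfun (fun t => f (tcons (y, t))).
  apply: (@bmfun_comp _ _ _ _ R (fun t => tcons (y, t)) f) => //.
  exact: measurableT_comp (@measurable_tcons R n) (measurable_pair1 y).
case: (unliftP ord0 i) => [j ->|->]; last first.
  rewrite cmeanS; last exact: bmfun_avg_at.
  rewrite (cmeanSr bf) -[RHS]avg_cst; congr avg; apply/funext => y.
  congr cmean; apply/funext => t; congr avg; apply/funext => z.
  by rewrite upd_tcons0.
rewrite [LHS]cmeanS; last exact: bmfun_avg_at.
rewrite [RHS](cmeanS bf); congr (avg _); apply/funext => y.
rewrite -[RHS](ih j _ (bfy y)); congr (cmean _); apply/funext => t.
congr (avg _).
by apply/funext => z; rewrite upd_tconsS.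
Qed.

(** A fresh coordinate 0 can be added without changing a mean: this supplies
    the auxiliary vertex of [edge_density0_spare]. *)
Lemma cmean_lift n (f : n.-tuple R -> R) (f' : n.+1.-tuple R -> R) :
  bmfun f' -> (forall y t, f' (tcons (y, t)) = f t) -> cmean f' = cmean f.
Proof.
move=> bf' ff'; rewrite cmeanS// -[RHS]avg_cst; congr avg; apply/funext => y.
by congr cmean; apply/funext => t; rewrite ff'.
Qed.

End cube.

(** * Integrating vertices out of a product of kernels *)

Section kernel_calculus.
Variable R : realType.
Implicit Types (W : R * R -> R) (phi : R -> R).

Definition edge_fun n W (i j : 'I_n) (t : n.-tuple R) : R :=
  W (tnth t i, tnth t j).

Definition vertex_fun n phi (i : 'I_n) (t : n.-tuple R) : R := phi (tnth t i).

(** The composition of kernels as integral operators. *)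
Definition kcomp W1 W2 (p : R * R) : R :=
  avg (fun z => W1 (p.1, z) * W2 (z, p.2)).

Definition deg W (x : R) : R := avg (fun y => W (x, y)).

Definition sym W := forall x y, W (x, y) = W (y, x).

Section dimension.
Variable n : nat.
Implicit Types (i j k : 'I_n) (f g : n.-tuple R -> R).

Lemma bmfun_edge W i j : bmfun W -> bmfun (edge_fun W i j).
Proof.
apply: (@bmfun_comp _ _ _ _ R (fun t : n.-tuple R => (tnth t i, tnth t j))).
by apply/measurable_fun_pair; exact: measurable_tnth.
Qed.

Lemma bmfun_vertex phi i : bmfun phi -> bmfun (vertex_fun phi i).
Proof.
by apply: (@bmfun_comp _ _ _ _ R (fun t : n.-tuple R => tnth t i));
  exact: measurable_tnth.
Qed.

Lemma bmfun_kcomp W1 W2 : bmfun W1 -> bmfun W2 -> bmfun (kcomp W1 W2).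
Proof.
move=> b1 b2.
apply: (@bmfun_avg _ _ _ (fun q : R * R * R => W1 (q.1.1, q.2) * W2 (q.2, q.1.2))).
have m1 : measurable_fun setT (fun q : R * R * R => (q.1.1, q.2)).
  apply/measurable_fun_pair; last exact: measurable_snd.
  exact: measurableT_comp measurable_fst measurable_fst.
have m2 : measurable_fun setT (fun q : R * R * R => (q.2, q.1.2)).
  apply/measurable_fun_pair; first exact: measurable_snd.
  exact: measurableT_comp measurable_snd measurable_fst.
exact: bmfunM (bmfun_comp m1 b1) (bmfun_comp m2 b2).
Qed.

Lemma bmfun_deg W : bmfun W -> bmfun (deg W).
Proof. by move=> bW; apply: (@bmfun_avg _ _ _ W). Qed.

Lemma free_edge W i j k : k != i -> k != j -> free_of k (edge_fun W i j).
Proof.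
move=> ki kj t y; rewrite /edge_fun !tnth_upd.
by rewrite (eq_sym i) (eq_sym j) (negbTE ki) (negbTE kj).
Qed.

Lemma free_vertex phi i k : k != i -> free_of k (vertex_fun phi i).
Proof. by move=> ki t y; rewrite /vertex_fun tnth_upd eq_sym (negbTE ki). Qed.

Lemma freeM k f g : free_of k f -> free_of k g -> free_of k (f * g).
Proof. by move=> ff fg t y; rewrite !fctE ff fg. Qed.

Lemma free_prod (I : eqType) (s : seq I) (P : pred I) (F : I -> n.-tuple R -> R) k :
  (forall e, P e -> free_of k (F e)) -> free_of k (\prod_(e <- s | P e) F e).
Proof.
move=> fF; elim/big_rec: _ => [//|e x Pe fx]; exact: freeM (fF _ Pe) fx.
Qed.

Lemma edge_funC W i j : sym W -> edge_fun W i j = edge_fun W j i.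
Proof. by move=> sW; apply/funext => t; exact: sW. Qed.

(** The one step by which all densities below are computed: average over a
    vertex k that occurs only in the factor f. *)
Lemma cmean_integrate k f g h : bmfun f -> bmfun g -> free_of k g ->
  avg_at k f = h -> cmean (f * g) = cmean (h * g).
Proof.
move=> bf bg fg <-; rewrite -avg_at_mulr// cmean_avg_at//; exact: bmfunM.
Qed.

Lemma cmean_path W1 W2 i j k g : bmfun W1 -> bmfun W2 -> bmfun g ->
  k != i -> k != j -> free_of k g ->
  cmean (edge_fun W1 i k * edge_fun W2 k j * g) =
  cmean (edge_fun (kcomp W1 W2) i j * g).
Proof.
move=> b1 b2 bg ki kj fg; apply: (@cmean_integrate k) => //.
  by apply: bmfunM; exact: bmfun_edge.
apply/funext => t; congr avg; apply/funext => y.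
rewrite !fctE /edge_fun !tnth_upd eqxx.
by rewrite (eq_sym i) (eq_sym j) (negbTE ki) (negbTE kj).
Qed.

Lemma cmean_pendant W i k g : bmfun W -> bmfun g -> k != i -> free_of k g ->
  cmean (edge_fun W i k * g) = cmean (vertex_fun (deg W) i * g).
Proof.
move=> bW bg ki fg; apply: (@cmean_integrate k) => //; first exact: bmfun_edge.
apply/funext => t; congr avg; apply/funext => y.
by rewrite /edge_fun !tnth_upd eqxx eq_sym (negbTE ki).
Qed.

Lemma cmean_point phi i g : bmfun phi -> bmfun g -> free_of i g ->
  cmean (vertex_fun phi i * g) = avg phi * cmean g.
Proof.
move=> bd bg fg; rewrite -cmeanZ//.
apply: (@cmean_integrate i _ _ (fun=> avg phi)) => //; first exact: bmfun_vertex.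
apply/funext => t; congr avg; apply/funext => y.
by rewrite /vertex_fun tnth_upd eqxx.
Qed.

Lemma cmean_vertex phi i : bmfun phi -> cmean (vertex_fun phi i) = avg phi.
Proof.
move=> bd; have := @cmean_point phi i 1 bd (bmfun_cst _ _) (fun _ _ => erefl).
by rewrite mulr1 => ->; rewrite [X in _ * X]cmean_cst mulr1.
Qed.

Lemma cmean_edge W i j : bmfun W -> i != j ->
  cmean (edge_fun W i j) = avg (deg W).
Proof.
move=> bW ij; rewrite -[edge_fun _ _ _]mulr1 cmean_pendant//; last 2 first.
- exact: bmfun_cst.
- by rewrite eq_sym.
by rewrite mulr1 cmean_vertex//; exact: bmfun_deg.
Qed.

End dimension.

(* Boundedness and measurability of products, distinctness of two vertices up
   to symmetry, and independence of a product from a vertex. *)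
Ltac bmf := repeat first
  [ assumption | apply: bmfunM | apply: bmfun_edge | apply: bmfun_vertex
  | apply: bmfun_kcomp | apply: bmfun_deg ].
Ltac neq := by [|rewrite eq_sym].
Ltac free := repeat apply: freeM;
  try (apply: free_edge; neq); try (apply: free_vertex; neq).

Variable W : R * R -> R.
Hypotheses (bW : bmfun W) (symW : sym W).

Let W2 := kcomp W W.
Let W3 := kcomp W2 W.

Definition cherry_density := avg (deg W * deg W).
Definition C4_density := avg (deg (W2 * W2)).
Definition C6_density := avg (deg (W3 * W3)).

Let bW2 : bmfun W2. Proof. by rewrite /W2; bmf. Qed.
Let bW3 : bmfun W3. Proof. by rewrite /W3; bmf. Qed.

Let symW2 : sym W2.
Proof.
move=> x y; congr avg; apply/funext => z /=.
by rewrite mulrC (symW x) (symW z).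
Qed.

(** The two ways of bracketing UUU agree up to transposition, since U and UU
    are symmetric. *)
Let W3E x y : kcomp W W2 (x, y) = W3 (y, x).
Proof.
by congr avg; apply/funext => z /=; rewrite mulrC symW (symW2 y).
Qed.

Section dimension_n.
Variable n : nat.
Implicit Types (a b c d e f : 'I_n) (g h : n.-tuple R -> R).
Notation K := (edge_fun W).

Lemma cherry_densityE a b c : a != b -> b != c -> a != c ->
  cmean (K a b * K b c) = cherry_density.
Proof.
move=> ab bc ac; rewrite (edge_funC a b symW).
rewrite cmean_pendant//; [|by bmf|by free].
rewrite mulrC cmean_pendant//; [|by bmf|neq|by free].
by rewrite /cherry_density -(cmean_vertex b)//; bmf.
Qed.

Lemma cherry_density_ge0 : 0 <= cherry_density.
Proof. by apply: mean_ge0 => x _; exact: sqr_ge0. Qed.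

Lemma matching_density_ge0 a b c d : a != b -> c != d ->
  a != c -> a != d -> b != c -> b != d -> 0 <= cmean (K a b * K c d).
Proof.
move=> ab cd ac ad bc bd.
rewrite cmean_pendant//; [|by bmf|neq|by free].
rewrite cmean_point; [|by bmf|by bmf|by free].
by rewrite cmean_edge//; exact: sqr_ge0.
Qed.

(** Averaging over the leaf b turns the edge into the degree function at a,
    which is orthogonal to everything once it is null. *)
Lemma leaf_density0 a b g : cherry_density = 0 -> bmfun g -> a != b ->
  free_of b g -> cmean (K a b * g) = 0.
Proof.
move=> c0 bg ab fg; rewrite cmean_pendant//; last by rewrite eq_sym.
apply: cmean_sqr0 => //; first by bmf.
by rewrite -c0 /cherry_density -(cmean_vertex a)//; bmf.
Qed.

Let sqr_W2 a c : a != c -> cmean (edge_fun W2 a c * edge_fun W2 a c) = C4_density.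
Proof. by move=> ac; rewrite /C4_density -(cmean_edge _ ac)//; bmf. Qed.

Let sqr_W3 a c : a != c -> cmean (edge_fun W3 a c * edge_fun W3 a c) = C6_density.
Proof. by move=> ac; rewrite /C6_density -(cmean_edge _ ac)//; bmf. Qed.

Lemma C4_densityE a b c d : uniq [:: a; b; c; d] ->
  cmean (K a b * K b c * K c d * K d a) = C4_density.
Proof.
rewrite /= !inE !negb_or -!andbA => /and5P[ab ac ad bc /and3P[bd cd _]].
rewrite -!mulrA mulrA cmean_path//; [|by bmf|neq|by free].
rewrite mulrC cmean_path//; [|by bmf|neq|neq|by free].
by rewrite -/W2 (edge_funC c a symW2) sqr_W2.
Qed.

Lemma C6_densityE a b c d e f : uniq [:: a; b; c; d; e; f] ->
  cmean (K a b * K b c * K c d * K d e * K e f * K f a) = C6_density.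
Proof.
rewrite /= !inE !negb_or -!andbA.
move=> /and5P[ab ac ad ae /and5P[af bc bd be /and5P[bf cd ce cf]]].
move=> /and4P[de df ef _].
rewrite -!mulrA mulrA cmean_path//; [|by bmf|neq|by free].
rewrite mulrA cmean_path//; [|by bmf|neq|by free].
rewrite -/W2 -/W3.
have -> : edge_fun W3 a d * (K d e * (K e f * K f a)) =
  K e f * K f a * (K d e * edge_fun W3 a d) by ring.
rewrite cmean_path//; [|by bmf|neq|neq|by free].
have -> : edge_fun (kcomp W W) e a * (K d e * edge_fun W3 a d) =
  K d e * edge_fun (kcomp W W) e a * edge_fun W3 a d by ring.
rewrite cmean_path//; [|by bmf|neq|neq|by free].
have -> : edge_fun (kcomp W (kcomp W W)) d a = edge_fun W3 a d.
  by apply/funext => t; exact: W3E.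
exact: sqr_W3 ad.
Qed.

(** A 4-cycle is a path of length three, i.e. UUU, paired with the edge that
    closes it. *)
Lemma C6_density0 a b c d : uniq [:: a; b; c; d] ->
  C6_density = 0 -> C4_density = 0.
Proof.
move=> u C60; rewrite -(C4_densityE u); move: u.
rewrite /= !inE !negb_or -!andbA => /and5P[ab ac ad bc /and3P[bd cd _]].
rewrite -!mulrA mulrA cmean_path//; [|by bmf|neq|by free].
rewrite mulrA cmean_path//; [|by bmf|neq|by free].
by apply: cmean_sqr0; rewrite ?sqr_W3//; bmf.
Qed.

(** Averaging over x and y, then over b and c, leaves t(z) t(a) where
    t(u) = UUU(u, u) is the density of triangles through u: the mean of a square
    if z = a, and the square of a mean otherwise. *)
Lemma two_triangle_density_ge0 a b c x y z : uniq [:: a; b; c; x; y] ->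
  x != z -> y != z -> (z == a) || (z \notin [:: b; c]) ->
  0 <= cmean (K a b * K b c * K c a * (K z x * K x y * K y z)).
Proof.
rewrite /= !inE !negb_or -!andbA.
move=> /and5P[ab ac ax ay /and5P[bc bx b_y cx /and3P[cy xy _]]] xz yz hz.
have bz : b != z by case/predU1P: hz => [->|/andP[? ?]]; neq.
have cz : c != z by case/predU1P: hz => [->|/andP[? ?]]; neq.
have -> : K a b * K b c * K c a * (K z x * K x y * K y z) =
  K a b * K b c * (K c a * (K z x * K x y * K y z)) by ring.
rewrite cmean_path//; [|by bmf|neq|by free].
have -> : edge_fun (kcomp W W) a c * (K c a * (K z x * K x y * K y z)) =
  edge_fun (kcomp W W) a c * K c a * (K z x * K x y * K y z) by ring.
rewrite cmean_path//; [|by bmf|neq|neq|by free].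
rewrite mulrC -!mulrA mulrA cmean_path//; [|by bmf|by free].
rewrite mulrA cmean_path//; [|by bmf|by free].
rewrite -/W2 -/W3; have [->|za] := eqVneq z a.
  by apply: cmean_ge0 => t; exact: sqr_ge0.
have bd : bmfun (fun u => W3 (u, u)).
  apply: (bmfun_comp (h := fun u : R => (u, u))) bW3.
  by apply/measurable_fun_pair; exact: measurable_id.
rewrite -[edge_fun W3 z z]/(vertex_fun (fun u => W3 (u, u)) z).
rewrite cmean_point//; [|by bmf|by free].
by rewrite [X in _ * X](cmean_vertex a bd); exact: sqr_ge0.
Qed.

(** Let G be the average over a of U(a, b) g.  The square of G is the average
    over a and over an independent copy c of a of U(a, b) U(b, c) g g', where g'
    is g with c in place of a.  As g and g' do not depend on b, averaging over
    b yields UU(a, c) g g', whose mean is 0 because UU is null.  So G is null,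
    and orthogonal to h. *)
Lemma edge_density0_spare a b c g h : C4_density = 0 -> bmfun g -> bmfun h ->
  a != b -> c != a -> c != b -> free_of b g -> free_of a h ->
  free_of c g -> free_of c h -> cmean (K a b * (g * h)) = 0.
Proof.
move=> C40 bg bh ab ca cb gb ha gc hc.
pose G := avg_at a (K a b * g).
have bKg : bmfun (K a b * g) by bmf.
have bG : bmfun G by exact: bmfun_avg_at.
rewrite mulrA (cmean_integrate bKg bh ha (erefl G)).
apply: cmean_sqr0 => //.
pose g' t := g (upd t a (tnth t c)).
have bg' : bmfun g'.
  apply: (@bmfun_comp _ _ _ _ R (fun t => upd t a (tnth t c)) g) => //.
  have mp : measurable_fun setT (fun t : n.-tuple R => (t, tnth t c)).
    by apply/measurable_fun_pair; [exact: measurable_id|exact: measurable_tnth].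
  exact: measurableT_comp (measurable_upd a) mp.
have GE : G = avg_at c (K c b * g').
  apply/funext => t; congr avg; apply/funext => y.
  rewrite !fctE /edge_fun /g' !tnth_upd !eqxx.
  rewrite eq_sym (negbTE ab) [b == c]eq_sym (negbTE cb).
  by rewrite updC// gc.
have g'a : free_of a g'.
  by move=> t y; rewrite /g' tnth_upd (negbTE ca) updK.
have g'b : free_of b g'.
  move=> t y; rewrite /g' tnth_upd (negbTE cb) updC; last neq.
  by rewrite gb.
have Gc : free_of c G by rewrite GE; exact: free_avg_at.
have -> : cmean (G * G) = cmean (K c b * g' * G).
  by rewrite {1}GE; apply/esym/(@cmean_integrate _ c); bmf.
have -> : cmean (K c b * g' * G) = cmean (K a b * g * (K c b * g')).
  rewrite mulrC; apply/esym/(@cmean_integrate _ a); bmf => //.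
  apply: freeM => //; free.
have -> : K a b * g * (K c b * g') = K a b * K b c * (g * g').
  by rewrite (edge_funC c b symW); ring.
rewrite cmean_path//; [|by bmf|neq|neq|exact: freeM].
by apply: cmean_sqr0; rewrite ?sqr_W2//; bmf; neq.
Qed.
End dimension_n.

(** The factors g and h may depend on every other vertex, so the copy of a is
    a new coordinate. *)
Lemma edge_density0 n (a b : 'I_n) g h : C4_density = 0 ->
  bmfun g -> bmfun h -> a != b -> free_of b g -> free_of a h ->
  cmean (edge_fun W a b * (g * h)) = 0.
Proof.
move=> C40 bg bh ab gb ha.
pose tl (t : n.+1.-tuple R) : n.-tuple R := [tuple of behead t].
have tlK y t : tl (tcons (y, t)) = t by exact: val_inj.
have mtl : measurable_fun setT tl by exact: measurable_behead.
have tlS t i y : tl (upd t (lift ord0 i) y) = upd (tl t) i y.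
  case/tupleP: t => x t.
  by rewrite -[[tuple of x :: t]]/(tcons (x, t)) upd_tconsS !tlK.
have tl0 t y : tl (upd t ord0 y) = tl t.
  case/tupleP: t => x t.
  by rewrite -[[tuple of x :: t]]/(tcons (x, t)) upd_tcons0 !tlK.
have bg' := bmfun_comp mtl bg; have bh' := bmfun_comp mtl bh.
rewrite -(@cmean_lift R n _
  (edge_fun W (lift ord0 a) (lift ord0 b) * ((g \o tl) * (h \o tl)))).
- apply: (@edge_density0_spare _ _ _ ord0) => //; try bmf.
  + by move=> t y; rewrite /= tlS gb.
  + by move=> t y; rewrite /= tlS ha.
  + by move=> t y; rewrite /= tl0.
  + by move=> t y; rewrite /= tl0.
- by bmf.
- by move=> y t; rewrite !fctE tlK /edge_fun !tnthS.
Qed.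

End kernel_calculus.

(** * Leafless sets of four or six edges *)

Section edges.
Variable F : sgraph.
Implicit Types (a b c d x y z : F) (S : {set F * F}).

(** The orientation of an edge under which [hom_density] lists it. *)
Definition edge a b : F * F :=
  if (enum_rank a < enum_rank b)%N then (a, b) else (b, a).

Lemma edgeC a b : edge a b = edge b a.
Proof.
rewrite /edge; case: ltngtP => // /val_inj ab.
by rewrite (enum_rank_inj ab).
Qed.

Lemma edge_eq a b c d :
  (edge a b == edge c d) = (a == c) && (b == d) || (a == d) && (b == c).
Proof.
have edgeP x y : edge x y = (x, y) \/ edge x y = (y, x) by rewrite /edge; case: ifP; auto.
apply/idP/idP.
  by case: (edgeP a b) (edgeP c d) => -> [] ->; rewrite xpair_eqE => /andP[-> ->];
    rewrite ?orbT.
by case/orP => /andP[/eqP-> /eqP->]; rewrite // edgeC.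
Qed.

Definition edges : {set F * F} := [set e | edge_pair e].

Lemma edge_edges a b : (edge a b \in edges) = adj a b.
Proof.
rewrite inE /edge_pair /edge; case: ltngtP => [ab|ba|/val_inj ab] /=.
- by rewrite ab andbT.
- by rewrite ba andbT adj_sym.
- by rewrite (enum_rank_inj ab) ltnn andbF adj_irrefl.
Qed.

Lemma edgesE e : e \in edges -> e = edge e.1 e.2.
Proof. by rewrite inE => /andP[_ lt]; rewrite /edge lt -surjective_pairing. Qed.

(** No vertex has degree exactly 1 in the graph with edge set S. *)
Definition leafless S :=
  forall a b, edge a b \in S -> exists2 c, edge b c \in S & a != c.

Section edge_set.
Variable S : {set F * F}.
Hypothesis SE : S \subset edges.

Lemma edge_neq a b : edge a b \in S -> a != b.
Proof.
move=> /(fintype.subsetP SE); rewrite edge_edges; apply: contraTneq => ->.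
by rewrite adj_irrefl.
Qed.

Lemma perm_edges (l : seq (F * F)) : uniq l -> all [in S] l ->
  (#|S| <= size l)%N -> perm_eq (enum S) l.
Proof.
move=> ul /allP lS szl; apply: uniq_perm => //; first exact: enum_uniq.
have lS' : {subset l <= enum S} by move=> e /lS; rewrite mem_enum.
have [|_ e] := uniq_min_size ul lS'; first by rewrite -cardE.
by move=> x; rewrite e.
Qed.

Lemma size_edges (l : seq (F * F)) : uniq l -> all [in S] l ->
  (size l <= #|S|)%N.
Proof.
move=> ul /allP lS; rewrite cardE; apply: uniq_leq_size => // e /lS.
by rewrite mem_enum.
Qed.

Lemma next_edge (l : seq (F * F)) : (size l < #|S|)%N ->
  exists x, exists2 y, edge x y \in S & edge x y \notin l.
Proof.
move=> szl; have [e eS el] : exists2 e, e \in S & e \notin l.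
  apply/exists_inP; rewrite -negb_forall_in; apply: contraL szl => /forall_inP Sl.
  rewrite -leqNgt cardE; apply: uniq_leq_size; first exact: enum_uniq.
  by move=> e; rewrite mem_enum => /Sl.
exists e.1, e.2; by rewrite -edgesE// (fintype.subsetP SE).
Qed.
End edge_set.

End edges.

Ltac decide_eqs := repeat match goal with
  | H : is_true (?x != ?y) |- context [?x == ?y] => rewrite (negbTE H)
  | H : is_true (?x != ?y) |- context [?y == ?x] => rewrite (eq_sym y x) (negbTE H)
  | |- context [?x == ?x] => rewrite (eqxx x)
  end.
(* Two edges of a list differ as soon as the known distinctness of their end
   vertices excludes both ways of matching them. *)
Ltac uniq_edges := rewrite /= ?inE ?edge_eq; decide_eqs;
  rewrite /= ?andbT ?andbF ?orbF //.
Ltac all_edges := rewrite /=; repeat (apply/andP; split=> //);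
  try assumption; rewrite edgeC; assumption.

Section walks.
Variables (F : sgraph) (S : {set F * F}).
Implicit Types a b c d x y z : F.
Hypotheses (SE : S \subset edges F) (lS : leafless S).

(** A fourth edge cannot have both ends among the vertices of a triangle. *)
Lemma triangle_exit a b c : edge a b \in S -> edge b c \in S -> edge c a \in S ->
  (3 < #|S|)%N -> exists x, exists2 y, edge x y \in S & x \notin [:: a; b; c].
Proof.
move=> sab sbc sca S3.
have [x [y sxy nxy]] : exists x, exists2 y, edge x y \in S &
  edge x y \notin [:: edge a b; edge b c; edge c a] by exact: next_edge.
have [xT|] := boolP (x \in [:: a; b; c]); last by exists x, y.
have [yT|] := boolP (y \in [:: a; b; c]); last by exists y, x; rewrite 1?edgeC.
case/negP: nxy; have xy := edge_neq SE sxy; move: xT yT xy.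
rewrite !inE => /or3P[] /eqP-> /or3P[] /eqP->; rewrite ?eqxx // => _;
  by rewrite !edge_eq !eqxx ?andbT ?orbT.
Qed.

(** A walk a, b, c, d, ... that never turns back can be continued at each step
    as there is no leaf.  If it does not close up as a 4-cycle, then either it
    closes up as a triangle, and a vertex off the triangle brings two more
    edges, or the walk of four edges leaves a second edge at a to be found:
    there are five edges in both cases. *)
Lemma leafless4 : #|S| = 4%N -> exists a b c d, uniq [:: a; b; c; d] /\
  perm_eq (enum S) [:: edge a b; edge b c; edge c d; edge d a].
Proof.
move=> S4.
have [a [b sab _]] : exists x, exists2 y, edge x y \in S & edge x y \notin [::].
  by apply: next_edge => //; rewrite S4.
have [c sbc ac] := lS sab.
have [d scd bd] := lS sbc.
have ab := edge_neq SE sab; have bc := edge_neq SE sbc; have cd := edge_neq SE scd.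
have [da|ad] := eqVneq a d.
  subst d; have [x [y sxy]] := triangle_exit sab sbc scd (eq_leq (esym S4)).
  rewrite !inE !negb_or => /and3P[xa xb xc].
  have [z sxz yz] : exists2 z, edge x z \in S & y != z by apply: lS; rewrite edgeC.
  have xy := edge_neq SE sxy; have xz := edge_neq SE sxz.
  suff : (5 <= #|S|)%N by rewrite S4.
  apply: (size_edges (l := [:: edge a b; edge b c; edge c a; edge x y; edge x z])).
    by uniq_edges.
  by all_edges.
have [e sde ce] := lS scd; have de := edge_neq SE sde.
have [ea|ae] := eqVneq e a.
  subst e; exists a, b, c, d; split.
    by uniq_edges.
  apply: perm_edges; rewrite ?S4 //; first by uniq_edges.
  by all_edges.
have [z saz bz] : exists2 z, edge a z \in S & b != z by apply: lS; rewrite edgeC.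
have az := edge_neq SE saz.
suff : (5 <= #|S|)%N by rewrite S4.
apply: (size_edges (l := [:: edge a b; edge b c; edge c d; edge d e; edge a z])).
  by uniq_edges.
by all_edges.
Qed.

Section hexagon.
Hypothesis S6 : #|S| = 6%N.
Hypothesis noC4 : forall a b c d, edge a b \in S -> edge b c \in S ->
  edge c d \in S -> edge d a \in S -> a != c -> b != d -> False.

(** A vertex off the triangle has two neighbours, not both on the triangle
    since S has no 4-cycle.  This gives an edge xy off the triangle, whose ends
    have further edges xz and yw; these are all six edges.  If z and w differ,
    both must lie on the triangle, for otherwise they would be leaves, and then
    x z w y is a 4-cycle.  So z = w, on the triangle or off it. *)
Lemma leafless6_triangle a b c :
    edge a b \in S -> edge b c \in S -> edge c a \in S ->
  exists x y z, [/\ uniq [:: a; b; c; x; y], x != z, y != z &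
   perm_eq (enum S) [:: edge a b; edge b c; edge c a; edge z x; edge x y; edge y z]].
Proof.
move=> sab sbc sca.
have ab := edge_neq SE sab; have bc := edge_neq SE sbc; have ca := edge_neq SE sca.
have sT u v : u \in [:: a; b; c] -> v \in [:: a; b; c] -> u != v -> edge u v \in S.
  rewrite !inE => /or3P[] /eqP-> /or3P[] /eqP->; rewrite ?eqxx// => _ //;
    by rewrite edgeC.
have thirdT u v : u \in [:: a; b; c] -> v \in [:: a; b; c] -> u != v ->
    exists w, [/\ w \in [:: a; b; c], w != u & w != v].
  rewrite !inE => /or3P[] /eqP-> /or3P[] /eqP->; rewrite ?eqxx// => _;
  [exists c|exists b|exists c|exists a|exists b|exists a];
  by rewrite !inE !eqxx ?orbT; split=> //; rewrite // eq_sym.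
have /(triangle_exit sab sbc sca)[x0 [y0 sxy0 xT]] : (3 < #|S|)%N by rewrite S6.
have [z0 sxz0 yz0] : exists2 z, edge x0 z \in S & y0 != z by apply: lS; rewrite edgeC.
(* one of the two neighbours of x0 is off the triangle *)
have [x [y [z [{}xT yT sxy sxz yz]]]] : exists x y z,
    [/\ x \notin [:: a; b; c], y \notin [:: a; b; c], edge x y \in S,
        edge x z \in S & y != z].
  have [yT|yT] := boolP (y0 \in [:: a; b; c]); last by exists x0, y0, z0.
  have [zT|zT] := boolP (z0 \in [:: a; b; c]); last first.
    by exists x0, z0, y0; split=> //; rewrite eq_sym.
  have [w [wT wy wz]] := thirdT _ _ yT zT yz0.
  exfalso; apply: (@noC4 x0 y0 w z0) => //.
  - by apply: sT => //; rewrite eq_sym.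
  - exact: sT.
  - by rewrite edgeC.
  - by apply: contraNneq xT => ->.
have [w syw xw] := lS sxy.
have xy := edge_neq SE sxy; have xz := edge_neq SE sxz; have yw := edge_neq SE syw.
move: (xT) (yT); rewrite !inE !negb_or => /and3P[xa xb xc] /and3P[ya yb yc].
have P : perm_eq (enum S) [:: edge a b; edge b c; edge c a; edge x y; edge x z; edge y w].
  apply: perm_edges; rewrite ?S6 //; first by uniq_edges.
  by all_edges.
have [zw|zw] := eqVneq z w.
  subst w; exists x, y, z; split=> //; first by uniq_edges.
  rewrite (permPl P) (edgeC z x) !perm_cons.
  exact/permPl/(perm_catCA [:: _] [:: _]).
have zT : z \in [:: a; b; c].
  apply/negPn/negP => zT; have [u szu xu] := lS sxz.
  have zu := edge_neq SE szu.
  move: szu; rewrite -mem_enum (perm_mem P).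
  by move: zT; rewrite !inE !negb_or => /and3P[za zb zc]; uniq_edges.
have wT : w \in [:: a; b; c].
  apply/negPn/negP => wT; have [u swu yu] := lS syw.
  have wu := edge_neq SE swu.
  move: swu; rewrite -mem_enum (perm_mem P).
  by move: wT; rewrite !inE !negb_or => /and3P[wa wb wc]; uniq_edges.
exfalso; apply: (@noC4 x z w y) => //.
- exact: sT.
- by rewrite edgeC.
- by rewrite edgeC.
- by rewrite eq_sym.
Qed.

(** Without triangles and 4-cycles, a walk a, b, c, d, e, f that never turns
    back has distinct vertices, except that f may be a.  In that case the sixth
    edge is not a chord of the pentagon, which would cut off a triangle, so it
    has an end off the pentagon, which needs a seventh edge.  Otherwise f has an
    edge fg besides ef and a has an edge besides ab; these are two different
    edges, seven in all, unless g = a. *)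
Lemma leafless6_hexagon :
  (forall a b c, edge a b \in S -> edge b c \in S -> edge c a \in S -> False) ->
  exists a b c d e f, uniq [:: a; b; c; d; e; f] /\
  perm_eq (enum S) [:: edge a b; edge b c; edge c d; edge d e; edge e f; edge f a].
Proof.
move=> noC3.
have [a [b sab _]] : exists x, exists2 y, edge x y \in S & edge x y \notin [::].
  by apply: next_edge => //; rewrite S6.
have [c sbc ac] := lS sab.
have [d scd bd] := lS sbc.
have [e sde ce] := lS scd.
have [f sef df] := lS sde.
have ab := edge_neq SE sab; have bc := edge_neq SE sbc; have cd := edge_neq SE scd.
have de := edge_neq SE sde; have ef := edge_neq SE sef.
have ad : a != d by apply/eqP => ad; subst d; exact: (noC3 a b c).
have be : b != e by apply/eqP => be; subst e; exact: (noC3 b c d).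
have cf : c != f by apply/eqP => cf; subst f; exact: (noC3 c d e).
have ae : a != e by apply/eqP => ae; subst e; exact: (@noC4 a b c d).
have bf : b != f by apply/eqP => bf; subst f; exact: (@noC4 b c d e).
have [fa|af] := eqVneq f a.
  (* a pentagon: its sixth edge is no chord *)
  subst f; exfalso.
  have [x [y [sxy nxy]]] : exists x y,
      edge x y \in S /\ x \notin [:: a; b; c; d; e].
    have [x [y sxy nxy]] : exists x, exists2 y, edge x y \in S &
        edge x y \notin [:: edge a b; edge b c; edge c d; edge d e; edge e a].
      by apply: next_edge => //; rewrite S6.
    have [xT|] := boolP (x \in [:: a; b; c; d; e]); last by exists x, y.
    have [yT|] := boolP (y \in [:: a; b; c; d; e]); last first.
      by exists y, x; rewrite 1?edgeC.
    exfalso; move: xT yT (sxy) nxy (edge_neq SE sxy); rewrite !inE.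
    case/or4P => [/eqP->|/eqP->|/eqP->|/orP[]/eqP->];
    case/or4P => [/eqP->|/eqP->|/eqP->|/orP[]/eqP->];
      rewrite ?eqxx ?edge_eq ?eqxx ?andbT ?orbT //= => s _ _;
    have s' := s; rewrite edgeC in s';
    by [ case: (noC3 _ _ _ sab sbc) | case: (noC3 _ _ _ sbc scd)
       | case: (noC3 _ _ _ scd sde) | case: (noC3 _ _ _ sde sef)
       | case: (noC3 _ _ _ sef sab) ].
  have [z sxz yz] : exists2 z, edge x z \in S & y != z by apply: lS; rewrite edgeC.
  have xy := edge_neq SE sxy; have xz := edge_neq SE sxz.
  move: nxy; rewrite !inE !negb_or => /and5P[xa xb xc xd xe].
  suff : (7 <= #|S|)%N by rewrite S6.
  apply: (size_edges (l := [:: edge a b; edge b c; edge c d; edge d e; edge e a;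
    edge x y; edge x z])); first by uniq_edges.
  by all_edges.
have [g sfg eg] := lS sef; have fg := edge_neq SE sfg.
have [ga|ag] := eqVneq g a.
  subst g; exists a, b, c, d, e, f; split; first by uniq_edges.
  apply: perm_edges; rewrite ?S6 //; first by uniq_edges.
  by all_edges.
have [h sah bh] : exists2 z, edge a z \in S & b != z by apply: lS; rewrite edgeC.
have ah := edge_neq SE sah.
suff : (7 <= #|S|)%N by rewrite S6.
apply: (size_edges (l := [:: edge a b; edge b c; edge c d; edge d e; edge e f; edge f g;
  edge a h])); first by uniq_edges.
by all_edges.
Qed.
End hexagon.
End walks.

(** * Densities of edge sets *)

Section subgraph_density.
Variables (R : realType) (F : sgraph) (W : R * R -> R).
Hypotheses (bW : bmfun W) (symW : sym W) (W1 : forall p, `|W p| <= 1).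
Implicit Types (a b c d x y z : F) (S : {set F * F}).
Notation rk := (@enum_rank F).
Notation K a b := (edge_fun W (rk a) (rk b)).

Definition edge_prod (e : F * F) : #|F|.-tuple R -> R := K e.1 e.2.

(** t(S, W) for the graph with edge set S on the vertices of F. *)
Definition density S : R := cmean (\prod_(e in S) edge_prod e).

Let rk_neq a b : (rk a != rk b) = (a != b).
Proof. by rewrite (inj_eq enum_rank_inj). Qed.

Let KC a b : K a b = K b a. Proof. exact: edge_funC. Qed.

Let bK a b : bmfun (K a b). Proof. exact: bmfun_edge. Qed.

Let bE e : bmfun (edge_prod e). Proof. exact: bK. Qed.

Lemma edge_prodE a b : edge_prod (edge a b) = K a b.
Proof. by rewrite /edge /edge_prod; case: ifP => //= _; exact: KC. Qed.

Lemma density_norm S : `|density S| <= 1.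
Proof.
apply: cmean_norm_le => [|t]; first by apply: bmfun_prod => e _; exact: bE.
rewrite fct_prodE; elim/big_ind: _ => [|x y x1 y1|e _]; last exact: W1.
- by rewrite normr1.
- by rewrite normrM mulr_ile1.
Qed.

Lemma density0 : density finset.set0 = 1.
Proof. by rewrite /density finset.big_set0 [LHS]cmean_cst. Qed.

Lemma density_list S l : perm_eq (enum S) l ->
  density S = cmean (\prod_(e <- l) edge_prod e).
Proof. by move=> Sl; rewrite /density -big_enum (perm_big _ Sl). Qed.

Lemma density_leaf S : S \subset edges F -> cherry_density W = 0 ->
  ~ leafless S -> density S = 0.
Proof.
move=> SE c0 nl.
have [a [b [sab leaf]]] : exists a b, edge a b \in S /\
    forall c, edge b c \in S -> a = c.
  apply: contrapT => no; apply: nl => a b sab; apply: contrapT => no2.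
  apply: no; exists a, b; split=> // c sbc.
  by apply/eqP/negPn/negP => ac; apply: no2; exists c.
rewrite /density (bigD1 _ sab)/= edge_prodE; apply: leaf_density0 => //.
- by apply: bmfun_prod => e _; exact: bE.
- by rewrite rk_neq (edge_neq SE sab).
- apply: free_prod => -[x y] /andP[xyS ne].
  have xyE : (x, y) = edge x y := edgesE (fintype.subsetP SE _ xyS).
  have {}xyS : edge x y \in S by rewrite -xyE.
  apply: free_edge; rewrite rk_neq; apply: contraNneq ne => bE';
    rewrite xyE; subst b; first by rewrite (leaf _ xyS) edgeC.
  by rewrite edgeC in xyS *; rewrite (leaf _ xyS) edgeC.
Qed.

(** Pick an edge ab of S.  No other edge contains both a and b, so the product
    of the others splits into a factor free of b and a factor free of a. *)
Lemma density_C4_0 S : S \subset edges F -> C4_density W = 0 ->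
  S != finset.set0 -> density S = 0.
Proof.
move=> SE c0 /finset.set0Pn[e0 e0S].
rewrite /density (bigD1 _ e0S)/=.
have e0E := edgesE (fintype.subsetP SE _ e0S).
move: (e0.1) (e0.2) e0E => a b e0E; subst e0.
rewrite edge_prodE (bigID (fun e => (e.1 != b) && (e.2 != b)))/=.
apply: edge_density0 => //.
- by apply: bmfun_prod => e _; exact: bE.
- by apply: bmfun_prod => e _; exact: bE.
- by rewrite rk_neq (edge_neq SE e0S).
- apply: free_prod => e /andP[_ /andP[b1 b2]].
  by apply: free_edge; rewrite rk_neq eq_sym.
- apply: free_prod => e /andP[/andP[eS ne]]; rewrite negb_and !negbK => eb.
  have ab := edge_neq SE e0S.
  have eE := edgesE (fintype.subsetP SE _ eS).
  apply: free_edge; rewrite rk_neq; apply: contraNneq ne => ae;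
    move: eb eE; rewrite -ae (negbTE ab) ?orbF /= => /eqP-> -> //.
  by rewrite edgeC.
Qed.

Let uniq_rk (l : seq F) : uniq (map rk l) = uniq l.
Proof. exact: (map_inj_uniq enum_rank_inj). Qed.

Lemma density_cherry S a b c : a != b -> b != c -> a != c ->
  perm_eq (enum S) [:: edge a b; edge b c] -> density S = cherry_density W.
Proof.
move=> ab bc ac Sl; rewrite (density_list Sl) !big_cons big_nil mulr1.
by rewrite !edge_prodE cherry_densityE// rk_neq.
Qed.

Lemma density2_ge0 S : S \subset edges F -> #|S| = 2%N -> 0 <= density S.
Proof.
move=> SE S2.
have [x [y sxy _]] : exists x, exists2 y, edge x y \in S & edge x y \notin [::].
  by apply: next_edge => //; rewrite S2.
have [z [w szw]] : exists x', exists2 y', edge x' y' \in S &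
    edge x' y' \notin [:: edge x y].
  by apply: next_edge => //; rewrite S2.
rewrite inE => ne.
have xy := edge_neq SE sxy; have zw := edge_neq SE szw.
have P : perm_eq (enum S) [:: edge x y; edge z w].
  apply: perm_edges; rewrite ?S2//=; first by rewrite inE eq_sym ne.
  by rewrite sxy szw.
have cherry u v r : v != u -> u != r -> v != r ->
    perm_eq (enum S) [:: edge v u; edge u r] -> 0 <= density S.
  by move=> ? ? ? Q; rewrite (density_cherry _ _ _ Q)//; exact: cherry_density_ge0.
have [xz|xz] := eqVneq x z.
  subst z; apply: (cherry x y w) => //; first by rewrite eq_sym.
    by apply: contraNneq ne => ->.
  by rewrite edgeC.
have [xw|xw] := eqVneq x w.
  subst w; apply: (cherry x y z) => //; first by rewrite eq_sym.
    by apply: contraNneq ne => ->; rewrite edgeC.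
  by rewrite edgeC (edgeC x z).
have [yz|yz] := eqVneq y z.
  by subst z; apply: (cherry y x w).
have [yw|yw] := eqVneq y w.
  by subst w; apply: (cherry y x z) => //; rewrite 1?eq_sym// (edgeC y z).
rewrite (density_list P) !big_cons big_nil mulr1 !edge_prodE.
by apply: matching_density_ge0; rewrite // rk_neq.
Qed.

Lemma density_C4 S a b c d : uniq [:: a; b; c; d] ->
  perm_eq (enum S) [:: edge a b; edge b c; edge c d; edge d a] ->
  density S = C4_density W.
Proof.
move=> u Sl; rewrite (density_list Sl) !big_cons big_nil mulr1 !edge_prodE.
rewrite !mulrA; apply: C4_densityE => //.
by rewrite -[X in uniq X]/(map rk [:: a; b; c; d]) uniq_rk.
Qed.

Lemma density_C6 S a b c d e f : uniq [:: a; b; c; d; e; f] ->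
  perm_eq (enum S) [:: edge a b; edge b c; edge c d; edge d e; edge e f; edge f a] ->
  density S = C6_density W.
Proof.
move=> u Sl; rewrite (density_list Sl) !big_cons big_nil mulr1 !edge_prodE.
rewrite !mulrA; apply: C6_densityE => //.
by rewrite -[X in uniq X]/(map rk [:: a; b; c; d; e; f]) uniq_rk.
Qed.

Lemma C4_density_ge0 : 0 <= C4_density W.
Proof. by do 2 (apply: mean_ge0 => ? _); exact: sqr_ge0. Qed.

Lemma C6_density_ge0 : 0 <= C6_density W.
Proof. by do 2 (apply: mean_ge0 => ? _); exact: sqr_ge0. Qed.

Lemma density_two_triangles S a b c x y z : uniq [:: a; b; c; x; y] ->
  x != z -> y != z ->
  perm_eq (enum S) [:: edge a b; edge b c; edge c a; edge z x; edge x y; edge y z] ->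
  0 <= density S.
Proof.
move=> u xz yz Sl; rewrite (density_list Sl) !big_cons big_nil mulr1.
rewrite !edge_prodE.
have key a' b' c' : uniq [:: a'; b'; c'; x; y] ->
    (z == a') || (z \notin [:: b'; c']) ->
    0 <= cmean (K a' b' * K b' c' * K c' a' * (K z x * K x y * K y z)).
  move=> u' hz; apply: two_triangle_density_ge0; rewrite ?rk_neq//.
    by rewrite -[X in uniq X]/(map rk [:: a'; b'; c'; x; y]) uniq_rk.
  by move: hz; rewrite !inE !(inj_eq enum_rank_inj).
(* If the triangles share a vertex, rotate the first one to make it a. *)
have [zb|zb] := eqVneq z b.
  rewrite (_ : _ * _ = K b c * K c a * K a b * (K z x * K x y * K y z)); last by ring.
  apply: key; last by rewrite zb eqxx.
  by rewrite (uniq_catCA [:: b; c] [:: a] [:: x; y]).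
have [zc|zc] := eqVneq z c.
  rewrite (_ : _ * _ = K c a * K a b * K b c * (K z x * K x y * K y z)); last by ring.
  apply: key; last by rewrite zc eqxx.
  by rewrite (uniq_catCA [:: c] [:: a; b] [:: x; y]).
rewrite (_ : _ * _ = K a b * K b c * K c a * (K z x * K x y * K y z)); last by ring.
by apply: key => //; rewrite !inE negb_or zb zc orbT.
Qed.

Lemma density4_ge0 S : S \subset edges F -> cherry_density W = 0 ->
  #|S| = 4%N -> 0 <= density S.
Proof.
move=> SE c0 S4; have [lf|nl] := pselect (leafless S); last first.
  by rewrite density_leaf.
have [a [b [c [d [u Sl]]]]] := leafless4 SE lf S4.
by rewrite (density_C4 u Sl) C4_density_ge0.
Qed.

Definition has_C4 := exists a b c d, uniq [:: a; b; c; d] /\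
  [&& adj a b, adj b c, adj c d & adj d a].

Lemma density6_ge0 S : S \subset edges F -> cherry_density W = 0 ->
  ~ has_C4 -> #|S| = 6%N -> 0 <= density S.
Proof.
move=> SE c0 nC4 S6; have [lf|nl] := pselect (leafless S); last first.
  by rewrite density_leaf.
have sadj a b : edge a b \in S -> adj a b.
  by move=> /(fintype.subsetP SE); rewrite edge_edges.
have noC4 a b c d : edge a b \in S -> edge b c \in S -> edge c d \in S ->
    edge d a \in S -> a != c -> b != d -> False.
  move=> sab sbc scd sda ac bd; apply: nC4; exists a, b, c, d; split.
    rewrite /= !inE !negb_or (edge_neq SE sab) (edge_neq SE sbc) (edge_neq SE scd).
    by rewrite ac bd eq_sym (edge_neq SE sda).
  by rewrite !sadj.
have [[a [b [c [sab sbc sca]]]]|noC3] := pselect (exists a b c,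
    [/\ edge a b \in S, edge b c \in S & edge c a \in S]).
  have [x [y [z [u xz yz Sl]]]] := leafless6_triangle SE lf S6 noC4 sab sbc sca.
  exact: density_two_triangles u xz yz Sl.
have [|a [b [c [d [e [f [u Sl]]]]]]] := leafless6_hexagon SE lf S6 noC4.
  by move=> a b c sab sbc sca; apply: noC3; exists a, b, c.
by rewrite (density_C6 u Sl) C6_density_ge0.
Qed.

End subgraph_density.

(** * Expansion in the perturbation parameter, and the theorem *)

(** The terms of odd order cancel, those of even order up to N are
    nonnegative, and the remaining ones are at least - 2 x^(N+1) each, which the
    positive term 2 t(j0) x^N outweighs when x is at most t(j0) / (#|J| + 1). *)
Lemma even_sum_ge0 (R : realFieldType) (J : finType) (P : pred J)
    (m : J -> nat) (t : J -> R) (N : nat) (j0 : J) :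
  P j0 -> m j0 = N -> ~~ odd N -> 0 < t j0 ->
  (forall j, P j -> `|t j| <= 1) ->
  (forall j, P j -> ~~ odd (m j) -> (m j <= N)%N -> 0 <= t j) ->
  exists2 e : R, 0 < e & forall x, 0 <= x <= e ->
    0 <= \sum_(j | P j) (x ^+ m j + (- x) ^+ m j) * t j.
Proof.
move=> P0 m0 N_even t0 t1 tN.
have J0 : 0 < #|J|%:R + 1 :> R by rewrite ltr_wpDl.
exists (Num.min 1 (t j0 / (#|J|%:R + 1))); first by rewrite lt_min ltr01 divr_gt0.
move=> x /andP[x0]; rewrite le_min => /andP[x1].
rewrite ler_pdivlMr// => xt.
have term j : P j -> - (2 * x ^+ N.+1) <= (x ^+ m j + (- x) ^+ m j) * t j.
  move=> Pj; have [mo|me] := boolP (odd (m j)).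
    by rewrite exprNn -signr_odd mo expr1 mulN1r subrr mul0r oppr_le0
      mulr_ge0// exprn_ge0.
  rewrite exprNn -signr_odd (negbTE me) expr0 mul1r.
  have -> : x ^+ m j + x ^+ m j = 2 * x ^+ m j by ring.
  have xm : 0 <= x ^+ m j by rewrite exprn_ge0.
  have [mN|Nm] := leqP (m j) N.
    apply: (@le_trans _ _ 0); first by rewrite oppr_le0 mulr_ge0// exprn_ge0.
    by rewrite mulr_ge0 ?tN// mulr_ge0.
  have xmN : x ^+ m j <= x ^+ N.+1 by apply: ler_wiXn2l.
  have := t1 j Pj; rewrite ler_norml => /andP[tj _].
  have := ler_wpM2l xm tj; rewrite mulrN1; lra.
rewrite (bigD1 j0)//= m0 exprNn -signr_odd (negbTE N_even) expr0 mul1r.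
have : \sum_(j | P j && (j != j0)) - (2 * x ^+ N.+1) <=
    \sum_(j | P j && (j != j0)) (x ^+ m j + (- x) ^+ m j) * t j.
  by apply: ler_sum => j /andP[Pj _]; exact: term.
rewrite sumr_const => /(le_trans _) h.
have xN : 0 <= x ^+ N by rewrite exprn_ge0.
have hc : - (2 * x ^+ N.+1) * #|J|%:R <=
    - (2 * x ^+ N.+1) *+ #|[pred j | P j & j != j0]|.
  rewrite mulr_natr !mulNrn lerN2 ler_wpMn2l ?max_card// mulr_ge0//.
  exact: exprn_ge0.
have := ler_wpM2l xN xt; have := h _ hc; rewrite exprS.
have : 0 <= x ^+ N * x by rewrite mulr_ge0.
move: (\sum_(_ | _) _) (x ^+ N) (#|J|%:R) => s y k; nra.
Qed.

Lemma prodr1D (R : comNzRingType) (I : finType) (A : {set I}) (x : I -> R) :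
  \prod_(i in A) (1 + x i) = \sum_(S : {set I} | S \subset A) \prod_(i in S) x i.
Proof.
pose y i := if i \in A then x i else 0.
transitivity (\prod_i (y i + 1)).
  rewrite big_mkcond/=; apply: eq_bigr => i _.
  by rewrite /y; case: ifP => _; rewrite ?add0r// addrC.
rewrite bigA_distr/= [RHS]big_mkcond/=; apply: eq_bigr => S _.
rewrite -big_mkcond/=; case: ifPn => [/fintype.subsetP SA|].
  by apply: eq_bigr => i /SA iA; rewrite /y iA.
by case/subsetPn => i iS iA; rewrite (bigD1 i)//= /y (negbTE iA) mul0r.
Qed.

Section expansion.
Variables (R : realType) (F : sgraph).

(** Extending a kernel by zero off the unit square makes it measurable, bounded
    and symmetric everywhere, without changing any density. *)
Lemma kernel_W1_extend (U : R * R -> R) : kernel_W1 U ->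
  let W := U \_ (@unit_square R) in [/\ bmfun W, sym W & forall p, `|W p| <= 1].
Proof.
move=> [[mU _ sU] U1] W.
have W1 p : `|W p| <= 1.
  rewrite /W patchE; case: ifPn => [/set_mem/U1|_]; last by rewrite normr0.
  by rewrite ler_norml.
have mS : measurable (@unit_square R).
  by apply: measurableX; exact: measurable_unit_itv.
split=> //; first by split; [exact/(measurable_restrictT U mS)|exists 1].
move=> x y; rewrite /W !patchE !in_setX/= andbC.
by case: ifPn => // /andP[/set_mem ? /set_mem ?]; exact: sU.
Qed.

Lemma hom_density_expand (U : R * R -> R) (c : R) : kernel_W1 U ->
  hom_density F (fun p => 1 + c * U p) =
  \sum_(S : {set F * F} | S \subset edges F)
     c ^+ #|S| * density (U \_ (@unit_square R)) S.
Proof.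
move=> /kernel_W1_extend/=; set W := U \_ _ => -[bW _ _].
have bp (S : {set F * F}) : bmfun (\prod_(e in S) @edge_prod R F W e).
  by apply: bmfun_prod => e _; exact: bmfun_edge.
transitivity (cmean (\sum_(S : {set F * F} | S \subset edges F)
    (fun t => c ^+ #|S| * (\prod_(e in S) @edge_prod R F W e) t))).
  apply: eq_Rintegral => t /set_mem tc; rewrite fct_sumE.
  under [RHS]eq_bigr => S _.
    rewrite fct_prodE -prodr_const -big_split/=; over.
  rewrite -(prodr1D _ (fun e => c * edge_prod W e t)).
  apply: eq_big => [e|e _]; first by rewrite inE.
  rewrite /edge_prod /edge_fun /W patchE mem_set//.
  by split; exact: tc.
rewrite cmean_sum; last by move=> S _; exact: bmfunZ.
by apply: eq_bigr => S _; rewrite cmeanZ.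
Qed.

Lemma edge_set_of_list (l : seq (F * F)) : uniq l -> all [in edges F] l ->
  exists S : {set F * F},
    [/\ S \subset edges F, #|S| = size l & perm_eq (enum S) l].
Proof.
move=> ul /allP le; exists [set e in l]%SET.
have P : perm_eq (enum [set e in l]%SET) l.
  by apply: uniq_perm; rewrite ?enum_uniq// => e; rewrite mem_enum inE.
split=> //; last by rewrite cardE (perm_size P).
by apply/fintype.subsetP => e; rewrite inE => /le.
Qed.

Lemma cherry_set (a b c : F) : adj a b -> adj b c -> a != c ->
  exists S : {set F * F},
    [/\ S \subset edges F, #|S| = 2%N & perm_eq (enum S) [:: edge a b; edge b c]].
Proof.
move=> ab bc ac.
have nab : a != b by apply: contraTneq ab => ->; rewrite adj_irrefl.
have nbc : b != c by apply: contraTneq bc => ->; rewrite adj_irrefl.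
apply: (@edge_set_of_list [:: edge a b; edge b c]).
  by rewrite /= inE edge_eq (negbTE nab) (negbTE ac).
by rewrite /= !edge_edges ab bc.
Qed.

Lemma C4_subgraph : contains F (cycle_graph 4) -> has_C4 F.
Proof.
move=> [f fi fh].
pose v i (lti : (i < 4)%N) := f (Ordinal lti).
exists (v 0%N isT), (v 1%N isT), (v 2%N isT), (v 3%N isT); split.
  by rewrite /= !inE /v !(inj_eq fi).
by apply/and4P; split; apply: fh.
Qed.

Definition has_C6 := exists a b c d e f : F, uniq [:: a; b; c; d; e; f] /\
  [&& adj a b, adj b c, adj c d, adj d e, adj e f & adj f a].

Lemma C6_subgraph : contains F (cycle_graph 6) -> has_C6.
Proof.
move=> [f fi fh].
pose v i (lti : (i < 6)%N) := f (Ordinal lti).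
exists (v 0%N isT), (v 1%N isT), (v 2%N isT), (v 3%N isT), (v 4%N isT),
  (v 5%N isT); split.
  by rewrite /= !inE /v !(inj_eq fi).
by do 5 (apply/andP; split; first by apply: fh); apply: fh.
Qed.

End expansion.

Theorem corollary4p2 (R : realType) (F : sgraph)
    (noiso : no_isolated F)
    (cyc : contains F (cycle_graph 4) \/ contains F (cycle_graph 6)) :
  weakly_locally_common R F.
Proof.
move=> U kU; have [] := kernel_W1_extend kU; set W := U \_ _ => bW symW W1.
pose P (S : {set F * F}) := (S \subset edges F) && (S != finset.set0).
pose T (S : {set F * F}) := @density R F W S.
pose rest (x : R) := \sum_(S | P S) (x ^+ #|S| + (- x) ^+ #|S|) * T S.
have expand x : hom_density F (fun p => 1 + x * U p) +
    hom_density F (fun p => 1 - x * U p) = 2 + rest x.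
  have -> : (fun p => 1 - x * U p) = (fun p => 1 + - x * U p).
    by apply/funext => p; rewrite mulNr.
  rewrite !hom_density_expand// -big_split/=.
  rewrite (bigD1 (finset.set0 : {set F * F})) ?finset.sub0set//=.
  rewrite finset.cards0 density0 !expr0 !mulr1; congr (_ + _).
  by apply: eq_bigr => S _; rewrite mulrDl.
suff [e e0 he] : exists2 e : R, 0 < e & forall x, 0 <= x <= e -> 0 <= rest x.
  by exists e => // x /he rx; rewrite expand lerDl.
have trivial_case : (forall S : {set F * F}, P S -> T S = 0) ->
    exists2 e : R, 0 < e & forall x, 0 <= x <= e -> 0 <= rest x.
  move=> T0; exists 1 => // x _; rewrite /rest big1// => S PS.
  by rewrite T0// mulr0.
have leading (S0 : {set F * F}) : S0 \subset edges F -> (0 < #|S0|)%N -> ~~ odd #|S0| ->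
    0 < T S0 -> (forall S : {set F * F}, P S -> ~~ odd #|S| -> (#|S| <= #|S0|)%N -> 0 <= T S) ->
    exists2 e : R, 0 < e & forall x, 0 <= x <= e -> 0 <= rest x.
  move=> S0E S00 oS0 TS0 TS; apply: (even_sum_ge0 (j0 := S0)) => //.
    by rewrite /P S0E -card_gt0.
  by move=> S _; exact: density_norm.
have P0 (S : {set F * F}) : P S -> (0 < #|S|)%N by case/andP; rewrite card_gt0.
have PE (S : {set F * F}) : P S -> S \subset edges F by case/andP.
have [c0|c0] := eqVneq (cherry_density W) 0; last first.
  have [a [b [c [ab bc ac]]]] : exists a b c : F, [/\ adj a b, adj b c & a != c].
    case: cyc => [/C4_subgraph|/C6_subgraph].
      move=> [a [b [c [d [u /and4P[ab bc _ _]]]]]]; exists a, b, c; split=> //.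
      by move: u; rewrite /= !inE !negb_or => /andP[/and3P[]].
    move=> [a [b [c [d [e [f [u /andP[ab /andP[bc _]]]]]]]]].
    exists a, b, c; split=> //.
    by move: u; rewrite /= !inE !negb_or => /andP[/and5P[]].
  have [S0 [S0E S02 S0l]] := cherry_set ab bc ac.
  apply: (leading S0); rewrite ?S02//.
    have nab : a != b by apply: contraTneq ab => ->; rewrite adj_irrefl.
    have nbc : b != c by apply: contraTneq bc => ->; rewrite adj_irrefl.
    rewrite /T (density_cherry bW symW nab nbc ac S0l).
    by rewrite lt_neqAle eq_sym c0 cherry_density_ge0.
  move=> S PS oS S2; apply: density2_ge0 (PE _ PS) _ => //.
  by move: oS S2 (P0 _ PS); case: #|S| => [|[|[|]]].
have [q0|q0] := eqVneq (C4_density W) 0.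
  apply: trivial_case => S PS; apply: density_C4_0 => //; first exact: PE.
  by case/andP: PS.
have q_gt0 : 0 < C4_density W by rewrite lt_neqAle eq_sym q0 C4_density_ge0.
have T4 (S : {set F * F}) : P S -> ~~ odd #|S| -> (#|S| <= 4)%N -> 0 <= T S.
  move=> PS oS S4; have [S2|S2] := eqVneq #|S| 2%N.
    by apply: density2_ge0 => //; exact: PE.
  apply: density4_ge0 => //; first exact: PE.
  by move: oS S2 S4 (P0 _ PS); case: #|S| => [|[|[|[|[|]]]]].
have [|nC4] := pselect (has_C4 F).
  move=> [a [b [c [d [u /and4P[ab bc cd da]]]]]].
  have [||S0 [S0E S04 S0l]] := @edge_set_of_list F
      [:: edge a b; edge b c; edge c d; edge d a].
  - move: u; rewrite /= !inE !negb_or -!andbA => /and5P[? ? ? ? /and3P[? ? _]].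
    by uniq_edges.
  - by rewrite /= !edge_edges ab bc cd da.
  by apply: (leading S0); rewrite ?S04 // /T (density_C4 bW symW u S0l).
have [a [b [c [d [e [f [u adjs]]]]]]] : has_C6 F.
  by case: cyc => [/C4_subgraph|/C6_subgraph].
case/and5P: adjs => ab bc cd de /andP[ef fa].
have [||S0 [S0E S06 S0l]] := @edge_set_of_list F
    [:: edge a b; edge b c; edge c d; edge d e; edge e f; edge f a].
- move: u; rewrite /= !inE !negb_or -!andbA.
  move=> /and5P[? ? ? ? /and5P[? ? ? ? /and5P[? ? ? ? /and4P[? ? ? _]]]].
  by uniq_edges.
- by rewrite /= !edge_edges ab bc cd de ef fa.
apply: (leading S0); rewrite ?S06//.
  rewrite /T (density_C6 bW symW u S0l) lt_neqAle C6_density_ge0 andbT eq_sym.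
  apply: contraNneq q0 => h0; apply/eqP.
  apply: (@C6_density0 R W bW symW #|F| (enum_rank a) (enum_rank b)
    (enum_rank c) (enum_rank d)) => //.
  rewrite -[X in uniq X]/(map enum_rank [:: a; b; c; d]).
  rewrite (map_inj_uniq enum_rank_inj).
  by move: u; rewrite (cat_uniq [:: a; b; c; d] [:: e; f]) => /andP[].
move=> S PS oS S6; have [S6'|S6'] := eqVneq #|S| 6%N.
  by apply: density6_ge0 => //; exact: PE.
apply: T4 => //; move: oS S6 S6'.
by case: #|S| => [|[|[|[|[|[|[|]]]]]]].
Qed.
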